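(* Let $P,Q$ be probability measures on $(\Omega,\mathcal{M})$, $g$ a bounded measurable real function on $\Omega$, and $\gamma\in\mathbb{R}\setminus\{0\}$. Define $$\Xi_+^\gamma(Q\|P,g)=\inf_{\beta>\gamma,\beta\ne0}\Big\{\frac1\beta\log\int e^{\beta g}dP-\frac1\gamma\log\int e^{\gamma g}dP+\frac{1}{\beta-\gamma}R_{\beta/(\beta-\gamma)}(Q\|P)\Big\},$$ $$\Xi_-^\gamma(Q\|P,g)=\sup_{\beta<\gamma,\beta\ne0}\Big\{\frac1\beta\log\int e^{\beta g}dP-\frac1\gamma\log\int e^{\gamma g}dP-\frac{1}{\gamma-\beta}R_{\gamma/(\gamma-\beta)}(P\|Q)\Big\}.$$ Then $$\Xi_-^\gamma(Q\|P,g)\le\frac1\gamma\log\int e^{\gamma g}dQ-\frac1\gamma\log\int e^{\gamma g}dP\le\Xi_+^\gamma(Q\|P,g).$$ Moreover: (1) $\Xi_-^\gamma(Q\|P,g)=-\Xi_+^{-\gamma}(Q\|P,-g)$; (2) $\pm\Xi_\pm^\gamma(Q\|P,g)\ge0$, and if $g$ is not $P$-a.s. constant then $\Xi_+^\gamma(Q\|P,g)=0$ iff $Q=P$, and $\Xi_-^\gamma(Q\|P,g)=0$ iff $Q=P$.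
   Context: Rényi divergence: let $\nu$ be a $\sigma$-finite positive measure with $dP=p\,d\nu$, $dQ=q\,d\nu$. For $\alpha\in(0,1)$, $R_\alpha(Q\|P)=\frac{1}{\alpha(\alpha-1)}\log\int_{p>0}q^\alpha p^{1-\alpha}\,d\nu$; for $\alpha>1$, the same formula if $Q\ll P$ and $R_\alpha(Q\|P)=+\infty$ if $Q\not\ll P$; for $\alpha<0$, $R_\alpha(Q\|P)=R_{1-\alpha}(P\|Q)$. *)

(* Defs.v *)
From HB Require Import structures.
From mathcomp Require Import all_boot all_order all_algebra.
From mathcomp Require Import all_classical all_reals all_analysis.
Set Implicit Arguments. Unset Strict Implicit. Unset Printing Implicit Defensive.
Import Order.TTheory GRing.Theory Num.Theory.
Local Open Scope classical_set_scope.
Local Open Scope ring_scope.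

(* Rényi divergence R_alpha(Q||P), for dQ = q dnu, dP = p dnu, following the
   paper's definition (alpha in (0,1), alpha > 1, alpha < 0). The values at
   alpha = 0 and alpha = 1 are never used; we set them to 0. *)
Definition renyi_pos {d} {T : measurableType d} {R : realType}
  (nu : {measure set T -> \bar R}) (Q P : set T -> \bar R) (q p : T -> R)
  (alpha : R) : \bar R :=
  if (0 < alpha < 1) ||
     ((1 < alpha) && `[< Q `<< P >])
  then (((alpha * (alpha - 1))^-1)%:E *
       lne (\int[nu]_(x in [set x | (0 < p x)%R]) ((q x `^ alpha) * (p x `^ (1 - alpha)))%R%:E))%E
  else if 1 < alpha then +oo%E
  else 0%E.

Definition renyi {d} {T : measurableType d} {R : realType}
  (nu : {measure set T -> \bar R}) (Q P : set T -> \bar R) (q p : T -> R)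
  (alpha : R) : \bar R :=
  if alpha < 0 then renyi_pos nu P Q p q (1 - alpha)
  else renyi_pos nu Q P q p alpha.

Definition cgf_term {d} {T : measurableType d} {R : realType}
  (P : set T -> \bar R) (g : T -> R) (b : R) : R :=
  b^-1 * ln (fine (\int[P]_x (expR (b * g x))%:E)).

Definition Xi_plus {d} {T : measurableType d} {R : realType}
  (nu : {measure set T -> \bar R}) (Q P : set T -> \bar R) (q p : T -> R)
  (g : T -> R) (gamma : R) : \bar R :=
  ereal_inf [set t | exists beta : R, [/\ gamma < beta, beta != 0 &
     t = ((cgf_term P g beta - cgf_term P g gamma)%:E +
          ((beta - gamma)^-1)%:E * renyi nu Q P q p (beta / (beta - gamma)))%E]].

Definition Xi_minus {d} {T : measurableType d} {R : realType}
  (nu : {measure set T -> \bar R}) (Q P : set T -> \bar R) (q p : T -> R)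
  (g : T -> R) (gamma : R) : \bar R :=
  ereal_sup [set t | exists beta : R, [/\ beta < gamma, beta != 0 &
     t = ((cgf_term P g beta - cgf_term P g gamma)%:E -
          ((gamma - beta)^-1)%:E * renyi nu P Q p q (gamma / (gamma - beta)))%E]].

(* Main.v *)
Require Import Defs.
From HB Require Import structures.
From mathcomp Require Import all_boot all_order all_algebra.
From mathcomp Require Import all_classical all_reals all_analysis.
From mathcomp Require Import measurable_realfun ring lra.
Import Order.TTheory GRing.Theory Num.Theory.
Local Open Scope classical_set_scope.
Local Open Scope ring_scope.

(** Everything follows from one application of Hölder's inequality.  With
    [a = beta / (beta - gamma)], [u = e^(gamma h) q] and [v = e^(beta h) p], the
    exponentials cancel in [u^a v^(1-a) = q^a p^(1-a)], whence
    [cgf Q h gamma <= cgf P h beta + R_a(Q||P) / (beta - gamma)]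
    for every bounded [h] and every admissible [beta].  Taking [h = 0] shows that
    the divergence term is nonnegative, taking [Q = P] that [cgf P h] is
    nondecreasing.  If [cgf P g] takes the same value [c] at [gamma < beta], then
    [E_P (e^(gamma (g-c)/2) - e^(beta (g-c)/2))^2 = 1 - 2 + 1 = 0], so [g = c]
    almost surely.  Hence, when [g] is not constant and [Xi_plus] vanishes, a
    minimizing sequence of [beta]'s tends to [gamma] while its divergence terms
    tend to [0]; the inequality for arbitrary [h] gives in the limit
    [cgf Q h gamma <= cgf P h gamma], and [h = 1_A] yields [Q A <= P A] for all
    [A], so that [Q = P].  The claims on [Xi_minus] follow by replacing
    [(g, gamma)] with [(- g, - gamma)]. *)

(** Keeps the order [beta / (beta - gamma)] away from 1, where [renyi] only has a dummy value. *)
Lemma div_subr_neq1 (F : fieldType) (x y : F) : y != 0 -> x - y != 0 ->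
  x / (x - y) != 1.
Proof.
move=> y0 xy; apply: contra_neq y0 => /(congr1 (fun z => z * (x - y))).
by rewrite mulfVK// mul1r => /esym/eqP; rewrite subr_eq -subr_eq0 opprD addNKr oppr_eq0 => /eqP.
Qed.

(** * Densities with respect to [nu] and Hölder's inequality for powers *)

Section density.
Set Implicit Arguments.
Unset Strict Implicit.
Context d (T : measurableType d) (R : realType).
Variable nu : {measure set T -> \bar R}.
Local Open Scope ereal_scope.

Lemma ge0_integral_density (P : probability T R) (p : T -> R) (f : T -> \bar R) :
  sigma_finite setT nu -> measurable_fun setT p -> (forall x, (0 <= p x)%R) ->
  (forall A, measurable A -> P A = \int[nu]_(x in A) (p x)%:E) ->
  measurable_fun setT f -> (forall x, 0 <= f x) ->
  \int[P]_x f x = \int[nu]_x (f x * (p x)%:E).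
Proof.
case: nu => m cm sfnu mp p0 Pp mf f0.
(* The hypothesis [sfnu] is bundled into a copy [nu'] of the measure, so that the Radon-Nikodym
   derivative of [P] exists; it then agrees with [p] almost everywhere. *)
pose sf := Measure_isSigmaFinite.Build _ _ _ (Measure.Pack cm) sfnu.
pose nu' : {sigma_finite_measure set T -> \bar R} :=
  HB.pack (Measure.sort (Measure.Pack cm)) sf.
have mEp : measurable_fun setT (EFin \o p) by exact/measurable_EFinP.
have Pnu : P `<< nu'.
  move=> A A0 B mB BA; rewrite Pp//.
  by apply: null_set_integral => //; [exact: measurable_funTS|exact: A0].
pose h := Radon_Nikodym_SigmaFinite.f P nu'.
have hi : nu'.-integrable setT h := Radon_Nikodym_SigmaFinite.f_integrable Pnu.
have hp : ae_eq nu' setT h (EFin \o p).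
  apply: (@integral_ae_eq _ _ _ nu') => // E _ mE.
  transitivity (P E); last exact: Pp.
  exact/esym/(Radon_Nikodym_SigmaFinite.f_integral Pnu).
rewrite -(Radon_Nikodym_SigmaFinite.change_of_variables Pnu)//.
apply: (@ae_eq_integral _ _ _ nu') => //.
- by apply: emeasurable_funM => //; exact: measurable_int hi.
- exact: emeasurable_funM.
- by move: hp; apply: filterS => x /= + _ => <-.
Qed.

Lemma density_ae_unique (P Q : probability T R) (p q : T -> R) :
  measurable_fun setT p -> measurable_fun setT q -> (forall x, (0 <= p x)%R) ->
  (forall A, measurable A -> P A = \int[nu]_(x in A) (p x)%:E) ->
  (forall A, measurable A -> Q A = \int[nu]_(x in A) (q x)%:E) ->
  (forall A, measurable A -> Q A = P A) ->
  {ae nu, forall x, q x = p x}.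
Proof.
move=> mp mq p0 Pp Qq QP.
have ip : nu.-integrable setT (EFin \o p).
  apply/integrableP; split; first exact/measurable_EFinP.
  under eq_integral do rewrite /= ger0_norm//.
  by rewrite -Pp// probability_setT ltry.
have : ae_eq nu setT (EFin \o p) (EFin \o q).
  apply: integral_ae_eq => //; first exact/measurable_EFinP.
  by move=> E _ mE; rewrite -Pp// -Qq// QP.
by apply: filterS => x /= /(_ I)[].
Qed.

(** The set where [p] vanishes is [P]-null, hence [Q]-null, so the nonnegative [q] has zero integral
    over it. *)
Lemma density_null_dominates (P Q : probability T R) (p q : T -> R) :
  measurable_fun setT p -> measurable_fun setT q ->
  (forall x, (0 <= q x)%R) ->
  (forall A, measurable A -> P A = \int[nu]_(x in A) (p x)%:E) ->
  (forall A, measurable A -> Q A = \int[nu]_(x in A) (q x)%:E) ->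
  Q `<< P -> {ae nu, forall x, p x = 0%R -> q x = 0%R}.
Proof.
move=> mp mq q0 Pp Qq QP.
pose A := p @^-1` [set 0%R].
have mA : measurable A by rewrite -[A]setTI; exact: mp.
have PA : P A = 0.
  by rewrite Pp//; apply: integral0_eq => x -> .
have : Q A = 0.
  by apply/(measure0_null_setP Q mA)/QP/(measure0_null_setP P mA).
rewrite Qq//; under eq_integral do rewrite -[(q _)%:E]gee0_abs ?lee_fin//.
move/(ae_eq_integral_abs nu mA _).1.
have /[swap]/[apply] : measurable_fun A (EFin \o q).
  by apply: measurable_funTS; exact/measurable_EFinP.
by apply: filterS => x /= + px => /(_ px)[].
Qed.

Lemma measurable_fun_powR (f : T -> R) (r : R) : measurable_fun setT f ->
  measurable_fun setT (fun x => f x `^ r)%R.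
Proof. by move=> mf; exact: (measurableT_comp (measurable_powR r)). Qed.

(** Hölder's inequality for the powers of [f] and [g], with conjugate exponents [t^-1] and
    [(1 - t)^-1]. *)
Lemma hoelder_powR (f g : T -> R) (t : R) : measurable_fun setT f ->
  measurable_fun setT g -> (forall x, (0 <= f x)%R) -> (forall x, (0 <= g x)%R) ->
  (0 < t < 1)%R ->
  \int[nu]_x (f x `^ t * g x `^ (1 - t))%:E <=
  (\int[nu]_x (f x)%:E) `^ t * (\int[nu]_x (g x)%:E) `^ (1 - t).
Proof.
move=> mf mg f0 g0 /andP[t0 t1].
have s0 : (0 < 1 - t)%R by rewrite subr_gt0.
have := @hoelder _ _ _ nu _ _ t^-1 (1 - t)^-1 (measurable_fun_powR t mf)
  (measurable_fun_powR (1 - t)%R mg).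
rewrite !invr_gt0 t0 s0 !invrK addrC subrK => /(_ isT isT erefl).
rewrite Lnorm1 unlock !invrK; congr (_ <= _).
  by apply: eq_integral => x _ /=; rewrite ger0_norm// mulr_ge0 ?powR_ge0.
by congr (_ `^ _ * _ `^ _); apply: eq_integral => x _ /=;
  rewrite ger0_norm ?powR_ge0// -powRrM mulfV ?gt_eqF// powRr1.
Qed.

End density.

(** * Logarithmic forms of Hölder's inequality and its reverse *)

Section hoelder_log.
Set Implicit Arguments.
Unset Strict Implicit.
Context d (T : measurableType d) (R : realType).
Variable nu : {measure set T -> \bar R}.
Implicit Types u v p q h : T -> R.
Implicit Types P Q : probability T R.

Lemma lne_hoelder_le u v (U V a : R) :
  measurable_fun setT u -> measurable_fun setT v ->
  (forall x, 0 <= u x) -> (forall x, 0 <= v x) ->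
  (\int[nu]_x (u x)%:E = U%:E)%E -> (\int[nu]_x (v x)%:E = V%:E)%E ->
  0 < U -> 0 < V -> 0 < a < 1 ->
  (lne (\int[nu]_x (u x `^ a * v x `^ (1 - a))%:E) <=
    (a * ln U + (1 - a) * ln V)%:E)%E.
Proof.
move=> mu mv u0 v0 intU intV U0 V0 a01.
have := hoelder_powR nu mu mv u0 v0 a01; rewrite intU intV => J_le.
have -> : a * ln U + (1 - a) * ln V = ln (U `^ a * V `^ (1 - a)).
  by rewrite lnM ?posrE ?powR_gt0// !ln_powR.
rewrite -lne_EFin ?mulr_gt0 ?powR_gt0// lee_lne//.
- rewrite in_itv/= leey andbT integral_ge0// => x _.
  by rewrite lee_fin mulr_ge0 ?powR_ge0.
- by rewrite in_itv/= leey andbT lee_fin mulr_ge0 ?powR_ge0.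
Qed.

(** Reverse Hölder: for [a > 1], the function [u] is the geometric mean of [w = u^a v^(1-a)] and [v]
    with weights [a^-1] and [1 - a^-1], so the direct inequality bounds [U] in terms of the integral
    of [w]. *)
Lemma lne_hoelder_ge u v (U V a : R) :
  measurable_fun setT u -> measurable_fun setT v ->
  (forall x, 0 <= u x) -> (forall x, 0 <= v x) ->
  (\int[nu]_x (u x)%:E = U%:E)%E -> (\int[nu]_x (v x)%:E = V%:E)%E ->
  0 < U -> 0 < V -> 1 < a -> {ae nu, forall x, v x = 0 -> u x = 0} ->
  ((a * ln U + (1 - a) * ln V)%:E <=
    lne (\int[nu]_x (u x `^ a * v x `^ (1 - a))%:E))%E.
Proof.
move=> mu mv u0 v0 intU intV U0 V0 a1 uv.
have a0 : 0 < a by exact: lt_trans a1.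
have aN0 : a != 0 by rewrite gt_eqF.
have t01 : 0 < a^-1 < 1 by rewrite invr_gt0 a0 invf_lt1.
pose w x := u x `^ a * v x `^ (1 - a).
have mw : measurable_fun setT w by apply: measurable_funM; exact: measurable_fun_powR.
have w0 x : 0 <= w x by rewrite mulr_ge0 ?powR_ge0.
have := hoelder_powR nu mw mv w0 v0 t01.
(* The powers of [v] cancel only where [v] is nonzero; elsewhere the hypothesis [uv] makes both
   sides 0. *)
have -> : (\int[nu]_x (w x `^ a^-1 * v x `^ (1 - a^-1))%:E = U%:E)%E.
  rewrite -intU; apply: ae_eq_integral => //.
  - apply/measurable_EFinP; apply: measurable_funM; exact: measurable_fun_powR.
  - exact/measurable_EFinP.
  apply: filterS uv => x uv _ /=; congr EFin; rewrite /w.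
  rewrite powRM ?powR_ge0// -!powRrM mulfV ?gt_eqF// powRr1// -mulrA.
  have [vx0|vx0] := eqVneq (v x) 0; first by rewrite uv// mul0r.
  rewrite -powRD ?vx0 ?implybT//.
  have -> : (1 - a) * a^-1 + (1 - a^-1) = 0 by field.
  by rewrite powRr0 mulr1.
rewrite intV -[X in lne X]/(\int[nu]_x (w x)%:E)%E.
have : (0 <= \int[nu]_x (w x)%:E)%E by apply: integral_ge0 => x _; rewrite lee_fin.
case: (\int[nu]_x (w x)%:E)%E => [j| |] //=; rewrite ?leey//.
rewrite !lee_fin => j0 Uj.
(* If [j] were 0, Hölder would give [U <= 0]; positivity puts [lne] in its finite branch. *)
have {}j0 : 0 < j.
  rewrite lt_neqAle j0 andbT; apply: contraTneq Uj => <-.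
  by rewrite powR0 ?mul0r -?ltNge// invr_eq0 gt_eqF.
rewrite (lt_geF j0) lee_fin.
have : ln U <= ln (j `^ a^-1 * V `^ (1 - a^-1)).
  by rewrite ler_ln ?posrE ?mulr_gt0 ?powR_gt0.
rewrite lnM ?posrE ?powR_gt0// !ln_powR => /(ler_wpM2l (ltW a0)).
have -> : a * (a^-1 * ln j + (1 - a^-1) * ln V) = ln j + (a - 1) * ln V by field.
by lra.
Qed.

(** The integrand lies between [expR (- (|b| M))] and [expR (|b| M)], and [P] has mass 1. Hence
    [fine] and [ln] in [cgf_term] act on a genuine positive real. *)
Lemma bounded_expR_integral P h (b : R) : measurable_fun setT h ->
  (exists M, forall x, `|h x| <= M) ->
  exists2 m : R, 0 < m & (\int[P]_x (expR (b * h x))%:E = m%:E)%E.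
Proof.
move=> mh [M hM].
have me : measurable_fun setT (fun x => (expR (b * h x))%:E).
  by apply/measurable_EFinP; apply: measurableT_comp => //; exact: measurable_funM.
have bh x : `|b * h x| <= `|b| * M by rewrite normrM ler_wpM2l.
have lo : ((expR (- (`|b| * M)))%:E <= \int[P]_x (expR (b * h x))%:E)%E.
  rewrite -[leLHS]mule1 -(probability_setT P) -integral_cst//.
  apply: ge0_le_integral => // x _; rewrite /= lee_fin ?expR_ge0//.
  by rewrite ler_expR; have := bh x; rewrite ler_norml => /andP[].
have hi : (\int[P]_x (expR (b * h x))%:E <= (expR (`|b| * M))%:E)%E.
  rewrite -[leRHS]mule1 -(probability_setT P) -integral_cst//.
  apply: ge0_le_integral => // x _; rewrite /= lee_fin ?expR_ge0//.
  by rewrite ler_expR; have := bh x; rewrite ler_norml => /andP[].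
move: lo hi; case: (\int[P]_x _)%E => [m| |] // lo _; exists m => //.
by rewrite (lt_le_trans (expR_gt0 _) lo).
Qed.

(** Since 0 to any nonzero power is 0 here, even to a negative one, the integrand vanishes where [p]
    does. *)
Lemma integral_powR_setT p q (a : R) : (forall x, 0 <= p x) -> a != 1 ->
  (\int[nu]_(x in [set x | (0 < p x)%R]) ((q x `^ a) * (p x `^ (1 - a)))%R%:E =
   \int[nu]_x (q x `^ a * p x `^ (1 - a))%:E)%E.
Proof.
move=> p0 a1; rewrite integral_mkcond; apply: eq_integral => x _.
rewrite patchE; case: ifPn => //.
rewrite notin_setE /= => /negP; rewrite -leNgt => px.
have -> : p x = 0 by apply/le_anti; rewrite px p0.
by rewrite powR0 ?mulr0// subr_eq0 eq_sym.
Qed.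

End hoelder_log.

(** * Rényi divergence: the Hölder bound, the case of equal measures, and symmetry *)

Section renyi_divergence.
Set Implicit Arguments.
Unset Strict Implicit.
Context d (T : measurableType d) (R : realType).
Variable nu : {measure set T -> \bar R}.
Implicit Types p q h : T -> R.
Implicit Types P Q : probability T R.

Definition has_density P p := [/\ measurable_fun setT p, forall x, 0 <= p x &
  forall A, measurable A -> P A = (\int[nu]_(x in A) (p x)%:E)%E].

Definition bounded_mfun h :=
  measurable_fun setT h /\ exists M : R, forall x, `|h x| <= M.

Lemma integral_expR_density P p h (b m : R) : sigma_finite setT nu ->
  has_density P p -> measurable_fun setT h ->
  (\int[P]_x (expR (b * h x))%:E = m%:E)%E ->
  (\int[nu]_x (expR (b * h x) * p x)%:E = m%:E)%E.
Proof.
move=> sf [mp p0 Pp] mh <-.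
rewrite (ge0_integral_density sf mp p0 Pp)//.
by apply/measurable_EFinP; apply: measurableT_comp => //; exact: measurable_funM.
Qed.

(** The sign of [a (a - 1)] always matches the direction of Hölder: negative on (0,1), where the
    direct inequality holds, and positive outside, where the reverse one does. Without the required
    absolute continuity, the divergence is infinite and the bound is trivial. *)
Lemma renyi_hoelder P Q p q h (beta gamma U V a : R) : sigma_finite setT nu ->
  has_density P p -> has_density Q q -> measurable_fun setT h ->
  gamma != 0 -> beta != 0 -> gamma < beta ->
  (\int[Q]_x (expR (gamma * h x))%:E = U%:E)%E -> 0 < U ->
  (\int[P]_x (expR (beta * h x))%:E = V%:E)%E -> 0 < V ->
  a = beta / (beta - gamma) ->
  (((a * (a - 1))^-1 * (a * ln U + (1 - a) * ln V))%:E <= renyi nu Q P q p a)%E.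
Proof.
move=> sf dP dQ mh g0 b0 gb QU U0 PV V0 aE.
have bg : beta - gamma != 0 by rewrite subr_eq0 gt_eqF.
have a0 : a != 0 by rewrite aE mulf_neq0 ?invr_eq0.
have a1 : a != 1 by rewrite aE div_subr_neq1.
pose u x := expR (gamma * h x) * q x.
pose v x := expR (beta * h x) * p x.
have intU : (\int[nu]_x (u x)%:E = U%:E)%E := integral_expR_density sf dQ mh QU.
have intV : (\int[nu]_x (v x)%:E = V%:E)%E := integral_expR_density sf dP mh PV.
have [mp p0 Pp] := dP; have [mq q0 Qq] := dQ.
have u0 x : 0 <= u x by rewrite mulr_ge0 ?expR_ge0.
have v0 x : 0 <= v x by rewrite mulr_ge0 ?expR_ge0.
have mu : measurable_fun setT u.
  by apply: measurable_funM => //; apply: measurableT_comp => //; exact: measurable_funM.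
have mv : measurable_fun setT v.
  by apply: measurable_funM => //; apply: measurableT_comp => //; exact: measurable_funM.
have uvE x : u x `^ a * v x `^ (1 - a) = q x `^ a * p x `^ (1 - a).
  rewrite !powRM ?expR_ge0// -!expRM mulrACA -expRD.
  have -> : gamma * h x * a + beta * h x * (1 - a) = 0 by rewrite aE; field.
  by rewrite expR0 mul1r.
have [aneg|apos|] := ltgtP a 0; last by move/eqP; rewrite (negbTE a0).
(* For [a < 0] the divergence is taken at order [1 - a > 1] with [P] and [Q] exchanged, so reverse
   Hölder is applied to [v] and [u] in this order. *)
- rewrite /renyi aneg /renyi_pos.
  have a'1 : 1 < 1 - a by lra.
  rewrite (_ : 0 < 1 - a < 1 = false) ?(lt_gtF a'1) ?andbF// a'1 /=.
  case: asboolP => PQ; last by rewrite leey.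
  have -> : (1 - a) * (1 - a - 1) = a * (a - 1) by ring.
  rewrite EFinM lee_pmul2l//; last by rewrite lte_fin invr_gt0 nmulr_rgt0//; lra.
  rewrite integral_powR_setT//; last by rewrite gt_eqF.
  have -> : (\int[nu]_x (p x `^ (1 - a) * q x `^ (1 - (1 - a)))%:E =
             \int[nu]_x (v x `^ (1 - a) * u x `^ (1 - (1 - a)))%:E)%E.
    by apply: eq_integral => x _; rewrite subKr mulrC -uvE mulrC.
  have -> : a * ln U + (1 - a) * ln V = (1 - a) * ln V + (1 - (1 - a)) * ln U.
    by rewrite subKr addrC.
  apply: lne_hoelder_ge => //.
  apply: filterS (density_null_dominates mq mp p0 Qq Pp PQ) => x pq /eqP.
  rewrite mulf_eq0 gt_eqF ?expR_gt0//= => /eqP/pq.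
  by rewrite /v => ->; rewrite mulr0.
- rewrite /renyi (lt_gtF apos) /renyi_pos apos /=.
  have [alt1|agt1|] := ltgtP a 1; last by move/eqP; rewrite (negbTE a1).
  (* Cancelling the negative prefactor flips the inequality, which leaves an upper bound on the
     logarithm. *)
  + rewrite /= integral_powR_setT// EFinM leNgt lte_nmul2l// -?leNgt; last first.
      by rewrite lte_fin invr_lt0 pmulr_rlt0//; lra.
    under eq_integral do rewrite -uvE.
    by apply: lne_hoelder_le => //; rewrite apos.
  + rewrite /=; case: asboolP => QP; last by rewrite leey.
    rewrite integral_powR_setT// EFinM lee_pmul2l//; last first.
      by rewrite lte_fin invr_gt0 pmulr_rgt0//; lra.
    under eq_integral do rewrite -uvE.
    apply: lne_hoelder_ge => //.
    apply: filterS (density_null_dominates mp mq q0 Pp Qq QP) => x pq /eqP.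
    rewrite mulf_eq0 gt_eqF ?expR_gt0//= => /eqP/pq.
    by rewrite /u => ->; rewrite mulr0.
Qed.

Lemma cgf_term_le_renyi P Q p q h (beta gamma : R) : sigma_finite setT nu ->
  has_density P p -> has_density Q q -> bounded_mfun h ->
  gamma != 0 -> beta != 0 -> gamma < beta ->
  ((cgf_term Q h gamma)%:E <= (cgf_term P h beta)%:E +
     ((beta - gamma)^-1)%:E * renyi nu Q P q p (beta / (beta - gamma)))%E.
Proof.
move=> sf dP dQ [mh hM] g0 b0 gb.
have [U U0 QU] := bounded_expR_integral Q gamma mh hM.
have [V V0 PV] := bounded_expR_integral P beta mh hM.
have := renyi_hoelder sf dP dQ mh g0 b0 gb QU U0 PV V0 erefl.
rewrite /cgf_term QU PV /=.
have bg : beta - gamma != 0 by rewrite subr_eq0 gt_eqF.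
set a := beta / (beta - gamma); set r := renyi _ _ _ _ _ _ => ler.
(* With [(a - 1) (beta - gamma) = gamma] and [a (beta - gamma) = beta], the coefficients of [ln U]
   and [ln V] in the scaled Hölder bound are [gamma^-1] and [- beta^-1]. *)
have -> : gamma^-1 * ln U = beta^-1 * ln V +
    (beta - gamma)^-1 * ((a * (a - 1))^-1 * (a * ln U + (1 - a) * ln V)).
  have -> : a - 1 = gamma / (beta - gamma) by rewrite /a; field.
  by rewrite /a; field; rewrite ?g0 ?b0 ?bg.
by rewrite EFinD leeD2lE// EFinM lee_pmul2l// lte_fin invr_gt0 subr_gt0.
Qed.

Lemma integral_powR_density_eq1 P Q p q (a : R) :
  has_density P p -> has_density Q q ->
  (forall A, measurable A -> Q A = P A) ->
  (\int[nu]_x (q x `^ a * p x `^ (1 - a))%:E = 1)%E.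
Proof.
move=> [mp p0 Pp] [mq q0 Qq] QP.
rewrite -(probability_setT P) Pp//; apply: ae_eq_integral => //.
- apply/measurable_EFinP; apply: measurable_funM; exact: measurable_fun_powR.
- exact/measurable_EFinP.
- apply: filterS (density_ae_unique mp mq p0 Pp Qq QP) => x -> _ /=.
  by rewrite -powRD subrKC ?oner_eq0// powRr1.
Qed.

Lemma renyi_pos_same P Q p q (a : R) :
  has_density P p -> has_density Q q ->
  (forall A, measurable A -> Q A = P A) -> a != 1 -> renyi_pos nu Q P q p a = 0%E.
Proof.
move=> dP dQ QP a1; have [_ p0 _] := dP.
rewrite /renyi_pos integral_powR_setT// (integral_powR_density_eq1 _ dP dQ)//.
rewrite lne1 mule0; case: ifPn => //; rewrite negb_or => /andP[_].
rewrite negb_and => /orP[/negbTE -> //|/asboolPn[]].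
by move=> A A0 B mB BA; rewrite QP//; exact: A0.
Qed.

Lemma renyi_same P Q p q (a : R) :
  has_density P p -> has_density Q q ->
  (forall A, measurable A -> Q A = P A) -> a != 1 -> renyi nu Q P q p a = 0%E.
Proof.
move=> dP dQ QP a1; rewrite /renyi; case: ifPn => a0; rewrite renyi_pos_same//.
- by move=> A mA; rewrite QP.
- by rewrite gt_eqF//; lra.
Qed.

(** Outside [0,1] both sides unfold to the same [renyi_pos]; inside (0,1) the prefactor and the
    integrand are invariant under exchanging the densities and replacing [a] by [1 - a]. *)
Lemma renyi_sym P Q p q (a : R) :
  has_density P p -> has_density Q q -> a != 0 -> a != 1 ->
  renyi nu P Q p q (1 - a) = renyi nu Q P q p a.
Proof.
move=> [_ p0 _] [_ q0 _] a0 a1; rewrite /renyi !subr_lt0 subKr.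
have [aneg|apos|] := ltgtP a 0; last by move/eqP; rewrite (negbTE a0).
  by rewrite ltNge (ltW (lt_trans aneg _)).
have [alt1|//|] := ltgtP a 1; last by move/eqP; rewrite (negbTE a1).
rewrite /renyi_pos !integral_powR_setT//; last by rewrite lt_eqF//; lra.
have -> : 0 < 1 - a < 1 by apply/andP; split; lra.
rewrite apos alt1 /=; congr (_%:E * lne _)%E; first by congr _^-1; ring.
by apply: eq_integral => x _; rewrite subKr mulrC.
Qed.

End renyi_divergence.

(** * Monotonicity of the scaled cumulant generating function and its equality case *)

Section cgf_term_theory.
Set Implicit Arguments.
Unset Strict Implicit.
Context d (T : measurableType d) (R : realType).
Implicit Types h : T -> R.
Implicit Types P Q : probability T R.

Lemma cgf_term0 P (b : R) : cgf_term P (fun=> 0) b = 0.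
Proof.
rewrite /cgf_term.
under eq_integral do rewrite mulr0 expR0.
by rewrite integral_cst//= probability_setT mule1 /= ln1 mulr0.
Qed.

(* [P] has density [1] with respect to itself, and its divergence from itself
   vanishes. *)
Lemma cgf_term_nondecreasing P h (beta gamma : R) : bounded_mfun h ->
  gamma != 0 -> beta != 0 -> gamma <= beta ->
  cgf_term P h gamma <= cgf_term P h beta.
Proof.
move=> bh g0 b0; rewrite le_eqVlt => /predU1P[->//|gb].
have d1 : has_density P P (fun=> 1).
  by split => // A mA; rewrite integral_cst// mul1e.
have := cgf_term_le_renyi (sigma_finiteT P) d1 d1 bh g0 b0 gb.
rewrite (renyi_same d1 d1) ?mule0 ?adde0 ?lee_fin//.
have bg : beta - gamma != 0 by rewrite subr_eq0 gt_eqF.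
exact: div_subr_neq1.
Qed.

Lemma cgf_term_eq_const P h (beta gamma : R) : bounded_mfun h ->
  gamma != 0 -> beta != 0 -> gamma < beta ->
  cgf_term P h beta <= cgf_term P h gamma ->
  {ae P, forall x, h x = cgf_term P h gamma}.
Proof.
move=> bh g0 b0 gb le_cgf.
set c := cgf_term P h gamma.
have [mh hM] := bh.
(* Monotonicity squeezes [cgf_term P h t] to [c] on the whole interval. The value [t = 0] is treated
   apart, because [0^-1 = 0] makes [cgf_term] uninformative there, and the midpoint used below may
   be 0. *)
have mgfE t : gamma <= t <= beta ->
    (\int[P]_x (expR (t * h x))%:E = (expR (t * c))%:E)%E.
  move=> /andP[gt tb].
  have [->|t0] := eqVneq t 0.
    under eq_integral do rewrite mul0r expR0.
    by rewrite integral_cst//= probability_setT mule1 mul0r expR0.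
  have [m m0 Em] := bounded_expR_integral P t mh hM.
  have : cgf_term P h t = c.
    apply/le_anti/andP; split; last exact: cgf_term_nondecreasing.
    exact: le_trans (cgf_term_nondecreasing _ _ _ _ _) le_cgf.
  rewrite /cgf_term Em /= => <-.
  by rewrite mulrA mulfV// mul1r lnK.
(* Twice [e m] is the cross term in the expansion of the square [F]. *)
pose m := (gamma + beta) / 2.
pose F x := (expR (gamma / 2 * (h x - c)) - expR (beta / 2 * (h x - c))) ^+ 2.
pose e t x := expR (t * (h x - c)).
have me t : measurable_fun setT (e t).
  apply: measurableT_comp => //; apply: measurable_funM => //.
  exact: measurable_funB.
have mF : measurable_fun setT F.
  by apply: measurable_funX; apply: measurable_funB; exact: me.
have FE x : F x + 2 * e m x = e gamma x + e beta x.
  rewrite /F /e /m; set y := h x - c.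
  have -> : expR (gamma * y) = expR (gamma / 2 * y) ^+ 2.
    by rewrite expr2 -expRD; congr expR; field.
  have -> : expR (beta * y) = expR (beta / 2 * y) ^+ 2.
    by rewrite expr2 -expRD; congr expR; field.
  have -> : expR ((gamma + beta) / 2 * y) = expR (gamma / 2 * y) * expR (beta / 2 * y).
    by rewrite -expRD; congr expR; field.
  by ring.
have Ie t : gamma <= t <= beta -> (\int[P]_x (e t x)%:E = 1)%E.
  move=> tgb.
  under eq_integral do rewrite /e mulrBr expRD mulrC EFinM.
  rewrite ge0_integralZl_EFin ?expR_ge0//.
    by rewrite mgfE// -EFinM -expRD addNr expR0.
  apply/measurable_EFinP; apply: measurableT_comp => //; exact: measurable_funM.
have e0 t x : (0 <= (e t x)%:E)%E by rewrite lee_fin expR_ge0.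
have intF0 : (\int[P]_x (F x)%:E = 0)%E.
  have : (\int[P]_x ((F x)%:E + (2 * e m x)%:E) =
          \int[P]_x ((e gamma x)%:E + (e beta x)%:E))%E.
    by apply: eq_integral => x _; rewrite -!EFinD FE.
  have F0 x : (0 <= (F x)%:E)%E by rewrite lee_fin sqr_ge0.
  have G0 x : (0 <= (2 * e m x)%:E)%E by rewrite lee_fin mulr_ge0// expR_ge0.
  rewrite !ge0_integralD//; try by apply/measurable_EFinP => //; exact: measurable_funM.
  under [X in (_ + X)%E = _ -> _]eq_integral do rewrite EFinM.
  rewrite ge0_integralZl_EFin//; last exact/measurable_EFinP.
  have gmb : gamma <= m <= beta by rewrite /m !midf_le ?ltW.
  rewrite !Ie// ?lexx ?(ltW gb)//.
  have : (0 <= \int[P]_x (F x)%:E)%E.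
    by apply: integral_ge0 => x _; rewrite lee_fin sqr_ge0.
  case: (\int[P]_x (F x)%:E)%E => //= r _; rewrite mule1 -!EFinD => -[r2].
  by congr EFin; lra.
have : ae_eq P setT (EFin \o F) (cst 0%E).
  apply/ae_eq_integral_abs => //; first exact/measurable_EFinP.
  rewrite -[RHS]intF0; apply: eq_integral => x _ /=.
  by rewrite ger0_norm// sqr_ge0.
apply: filterS => x /= /(_ I)[/eqP].
rewrite sqrf_eq0 subr_eq0 => /eqP/expR_inj/eqP.
rewrite -subr_eq0 -mulrBl mulf_eq0 subr_eq0 => /orP[/eqP|/eqP]; first lra.
by lra.
Qed.

End cgf_term_theory.

(** * Continuity in the parameter, and indicators as test functions *)

Section cgf_term_regularity.
Import numFieldNormedType.Exports.
Set Implicit Arguments.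
Unset Strict Implicit.
Context d (T : measurableType d) (R : realType).
Implicit Types h : T -> R.
Implicit Types P Q : probability T R.

(** Pointwise [s h <= t h + M |s - t|], so the integrals differ by at most the factor
    [expR (M |s - t|)]. *)
Lemma ln_mgf_lipschitz P h (M s t : R) : measurable_fun setT h ->
  (forall x, `|h x| <= M) ->
  ln (fine (\int[P]_x (expR (s * h x))%:E)) <=
  ln (fine (\int[P]_x (expR (t * h x))%:E)) + M * `|s - t|.
Proof.
move=> mh hM; have hb : exists M : R, forall x, `|h x| <= M by exists M.
have [m m0 Em] := bounded_expR_integral P s mh hb.
have [n n0 En] := bounded_expR_integral P t mh hb.
have me r : measurable_fun setT (fun x => (expR (r * h x))%:E).
  by apply/measurable_EFinP; apply: measurableT_comp => //; exact: measurable_funM.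
have : (\int[P]_x (expR (s * h x))%:E <=
    \int[P]_x ((expR (M * `|s - t|))%:E * (expR (t * h x))%:E))%E.
  apply: ge0_le_integral => //.
  - by apply: emeasurable_funM.
  - move=> x _; rewrite -EFinM -expRD lee_fin ler_expR -lerBlDr -mulrBl.
    by rewrite (le_trans (ler_norm _))// normrM mulrC ler_wpM2r.
rewrite ge0_integralZl_EFin ?expR_ge0// Em En -EFinM lee_fin /= => mn.
rewrite addrC -[X in X + _]expRK -lnM ?posrE ?expR_gt0//.
by rewrite ler_ln ?posrE ?mulr_gt0 ?expR_gt0.
Qed.

Lemma cvg_cgf_term P h (gamma : R) : bounded_mfun h -> gamma != 0 ->
  cgf_term P h b @[b --> gamma] --> cgf_term P h gamma.
Proof.
move=> [mh [K hK]] g0; apply: cvgM; first exact: cvgV.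
(* The added 1 makes [M] positive, so that [e / M] is a valid radius. *)
pose M := `|K| + 1; have M0 : 0 < M by rewrite ltr_wpDl.
have hM x : `|h x| <= M by rewrite (le_trans (hK x))// (le_trans (ler_norm K))// lerDl.
pose L b := ln (fine (\int[P]_x (expR (b * h x))%:E)).
have LM s t : L s <= L t + M * `|s - t| by exact: ln_mgf_lipschitz.
apply/cvgrPdist_le => e e0.
near=> b; have := LM gamma b; have := LM b gamma.
rewrite -/(L gamma) -/(L b) [`|b - gamma|]distrC => h1 h2.
have : M * `|gamma - b| <= e.
  rewrite mulrC -ler_pdivlMr//; near: b.
  apply: (@cvgr_dist_le _ _ _ _ _ id) => //; exact: divr_gt0.
by move=> Me; rewrite ler_distl lerBlDr (le_trans h1) ?lerD2l// (le_trans h2)// lerD2l.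
Unshelve. all: by end_near. Qed.

Lemma mgf_indic P A (b : R) : measurable A ->
  (\int[P]_x (expR (b * \1_A x))%:E = (1 + (expR b - 1) * fine (P A))%:E)%E.
Proof.
move=> mA.
have E x : (expR (b * \1_A x))%:E = ((\1_(~` A) x)%:E + (expR b)%:E * (\1_A x)%:E)%E.
  rewrite !indicE in_setC; case: (x \in A) => /=.
    by rewrite mulr1 mule1 add0e.
  by rewrite mulr0 expR0 mule0 adde0.
under eq_integral do rewrite E.
have mi B : measurable B -> measurable_fun setT (fun x : T => (\1_B x : R)%:E).
  by move=> mB; apply/measurable_EFinP; exact: measurable_indic.
rewrite ge0_integralD//; last 2 first.
- by apply: mi; exact: measurableC.
- by apply: emeasurable_funM => //; exact: mi.
rewrite ge0_integralZl_EFin ?expR_ge0//; last exact: mi.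
rewrite !integral_indic//; last exact: measurableC.
rewrite !setIT /= probability_setC//.
have : P A \is a fin_num by exact: fin_num_measure.
move=> /fineK => PA; rewrite -{1 2}PA -EFinM -EFinB -EFinD.
by congr EFin; ring.
Qed.

(** For [h = 1_A] the two sides are [gamma^-1 * ln (1 + (expR gamma - 1) x)] at [x = Q A] and
    [x = P A]. This is increasing in [x] for either sign of [gamma], since [gamma^-1] and
    [expR gamma - 1] have the same sign. *)
Lemma cgf_term_le_measure P Q (gamma : R) : gamma != 0 ->
  (forall h, bounded_mfun h -> cgf_term Q h gamma <= cgf_term P h gamma) ->
  forall A, measurable A -> (Q A <= P A)%E.
Proof.
move=> g0 QP A mA.
have bA : bounded_mfun (\1_A : T -> R).
  split; first exact: measurable_indic.
  by exists 1 => x; rewrite indicE; case: (_ \in _); rewrite ?normr1 ?normr0.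
have := QP _ bA; rewrite /cgf_term !mgf_indic//=.
have fP : P A \is a fin_num by exact: fin_num_measure.
have fQ : Q A \is a fin_num by exact: fin_num_measure.
rewrite -[in X in _ -> X](fineK fP) -[in X in _ -> X](fineK fQ) lee_fin.
have pos (S : probability T R) : 0 < 1 + (expR gamma - 1) * fine (S A).
  have := expR_gt0 gamma.
  have : 0 <= fine (S A) by rewrite fine_ge0.
  have : fine (S A) <= 1.
    have fS : S A \is a fin_num by exact: fin_num_measure.
    by rewrite -lee_fin fineK// probability_le1.
  by move=> ? ? ?; nra.
have [gneg|gpos|] := ltgtP gamma 0; last by move/eqP; rewrite (negbTE g0).
- have : expR gamma < 1 by rewrite expR_lt1.
  move=> eg; rewrite ler_nM2l ?invr_lt0// ler_ln ?posrE// lerD2l.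
  by rewrite ler_nM2l// subr_lt0.
- have : 1 < expR gamma by rewrite expR_gt1.
  move=> eg; rewrite ler_pM2l ?invr_gt0// ler_ln ?posrE// lerD2l.
  by rewrite ler_pM2l// subr_gt0.
Qed.

(** The inequality on the complement of [A] is the reverse inequality on [A], as both masses are
    1. *)
Lemma probability_le_eq P Q : (forall A, measurable A -> (Q A <= P A)%E) ->
  forall A, measurable A -> Q A = P A.
Proof.
move=> QP A mA; apply/le_anti; rewrite QP//=.
have := QP _ (measurableC mA); rewrite !probability_setC//.
by rewrite leeD2lE// leeN2.
Qed.

End cgf_term_regularity.

(** * Bounds, vanishing and reflection of [Xi_plus] and [Xi_minus] *)

Section Xi_theory.
Import numFieldNormedType.Exports.
Set Implicit Arguments.
Unset Strict Implicit.
Context d (T : measurableType d) (R : realType).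
Variables (nu : {measure set T -> \bar R}) (P Q : probability T R) (p q : T -> R).
Implicit Types (g : T -> R) (beta gamma : R).
Hypotheses (sf : sigma_finite setT nu).
Hypotheses (dP : has_density nu P p) (dQ : has_density nu Q q).

Lemma bounded_mfunN g : bounded_mfun g -> bounded_mfun (fun x => - g x).
Proof.
move=> [mg [M gM]]; split; first exact: measurable_funN.
by exists M => x; rewrite normrN.
Qed.

Lemma cgf_termN (S : probability T R) g gamma :
  cgf_term S (fun x => - g x) (- gamma) = - cgf_term S g gamma.
Proof.
rewrite /cgf_term invrN mulNr; congr (- (_ * ln (fine _))).
by apply: eq_integral => x _; rewrite mulrNN.
Qed.

Lemma renyi_term_ge0 beta gamma : gamma != 0 -> beta != 0 -> gamma < beta ->
  (0 <= ((beta - gamma)^-1)%:E * renyi nu Q P q p (beta / (beta - gamma)))%E.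
Proof.
move=> g0 b0 gb.
have b0f : bounded_mfun (fun _ : T => 0 : R).
  by split => //; exists 0 => x; rewrite normr0.
by have := cgf_term_le_renyi sf dP dQ b0f g0 b0 gb; rewrite !cgf_term0 add0e.
Qed.

Lemma cgf_term_le_Xi_plus g gamma : bounded_mfun g -> gamma != 0 ->
  ((cgf_term Q g gamma - cgf_term P g gamma)%:E <= Xi_plus nu Q P q p g gamma)%E.
Proof.
move=> bg g0; apply: le_ereal_inf_tmp => _ [beta [gb b0 ->]].
rewrite !EFinB addeAC leeD2rE//.
exact: cgf_term_le_renyi.
Qed.

Lemma Xi_plus_ge0 g gamma : bounded_mfun g -> gamma != 0 ->
  (0 <= Xi_plus nu Q P q p g gamma)%E.
Proof.
move=> bg g0; apply: le_ereal_inf_tmp => _ [beta [gb b0 ->]].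
apply: adde_ge0; last exact: renyi_term_ge0.
by rewrite lee_fin subr_ge0 cgf_term_nondecreasing// ltW.
Qed.

Lemma near_gt_neq0 gamma (e : R) : gamma != 0 -> 0 < e ->
  exists2 beta, gamma < beta < gamma + e & beta != 0.
Proof.
move=> g0 e0; have [gneg|gpos|] := ltgtP gamma 0; last by move/eqP; rewrite (negbTE g0).
(* Capping at [gamma / 2] keeps the witness negative, hence away from the excluded value 0. *)
- exists (Num.min (gamma + e / 2) (gamma / 2)).
    by rewrite lt_min gt_min; apply/andP; split;
      [apply/andP; split|apply/orP; left]; lra.
  by rewrite lt_eqF// gt_min; apply/orP; right; lra.
- exists (gamma + e / 2); first by apply/andP; split; lra.
  by rewrite gt_eqF//; lra.
Qed.

Lemma cgf_term_right_continuous (S : probability T R) g gamma (e : R) :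
  bounded_mfun g -> gamma != 0 -> 0 < e ->
  exists2 r : R, 0 < r & forall beta, gamma < beta < gamma + r ->
    cgf_term S g beta < cgf_term S g gamma + e.
Proof.
move=> bg g0 e0; have /cvgrPdist_lt/(_ e e0) := cvg_cgf_term (P := S) bg g0.
case/nbhs_ballP => r /= r0 H; exists r => // beta /andP[gb br].
have /H : ball gamma r beta.
  by rewrite /ball/= distrC gtr0_norm ?subr_gt0// ltrBlDl.
by rewrite /= ltr_distl ltrBlDr => /andP[].
Qed.

(** All divergence terms vanish, and the remaining difference of [cgf_term] values tends to 0 as
    [beta] decreases to [gamma]. *)
Lemma Xi_plus_eq0 g gamma : bounded_mfun g -> gamma != 0 ->
  (forall A, measurable A -> Q A = P A) -> Xi_plus nu Q P q p g gamma = 0%E.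
Proof.
move=> bg g0 QP; apply/le_anti/andP; split; last exact: Xi_plus_ge0.
apply/lee_addgt0Pr => e e0; rewrite add0e.
have [r r0 Hr] := cgf_term_right_continuous P bg g0 e0.
have [beta bI b0] := near_gt_neq0 g0 r0.
have /andP[gb _] := bI.
apply: ge_ereal_inf; exists ((cgf_term P g beta - cgf_term P g gamma)%:E).
  exists beta; split => //; rewrite (renyi_same dP dQ QP) ?mule0 ?adde0//.
  have bgN : beta - gamma != 0 by rewrite subr_eq0 gt_eqF.
  exact: div_subr_neq1.
by rewrite lee_fin lerBlDl ltW// Hr.
Qed.

Lemma Xi_plus_eq0_same g gamma : bounded_mfun g -> gamma != 0 ->
  ~ (exists c : R, {ae P, forall x, g x = c}) ->
  Xi_plus nu Q P q p g gamma = 0%E -> forall A, measurable A -> Q A = P A.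
Proof.
move=> bg g0 gN Xi0; apply: probability_le_eq.
apply: (cgf_term_le_measure g0) => h bh.
suff le_e (e : R) : 0 < e -> cgf_term Q h gamma <= cgf_term P h gamma + e.
  by apply/ler_addgt0Pr => e; exact: le_e.
move=> e0.
have e20 : 0 < e / 2 by rewrite divr_gt0.
have [r r0 Hr] := cgf_term_right_continuous P bh g0 e20.
have [beta1 /andP[gb1 b1r] b10] := near_gt_neq0 g0 r0.
(* The gap [k] is positive because [g] is not constant. An element of the infimum set below [k] must
   come from some [beta < beta1], and one below [e / 2] has a divergence term below [e / 2]. *)
pose k := cgf_term P g beta1 - cgf_term P g gamma.
have k0 : 0 < k.
  rewrite subr_gt0 ltNge; apply/negP => /(cgf_term_eq_const bg g0 b10 gb1) gc.
  by apply: gN; exists (cgf_term P g gamma).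
have : (Xi_plus nu Q P q p g gamma < (Num.min k (e / 2))%:E)%E.
  by rewrite Xi0 lte_fin lt_min k0.
move=> /ereal_inf_lt[_ [beta [gb b0 ->]]].
have D0 := renyi_term_ge0 g0 b0 gb.
have := cgf_term_le_renyi sf dP dQ bh g0 b0 gb.
move: D0; set D := (_ * renyi _ _ _ _ _ _)%E.
have cg0 : cgf_term P g gamma <= cgf_term P g beta.
  by rewrite cgf_term_nondecreasing// ltW.
case: D => // D; rewrite -EFinD !lee_fin lte_fin => D0 hD.
rewrite lt_min => /andP[Dk De].
(* Otherwise monotonicity would make the [cgf_term] difference alone at least [k]. *)
have bb1 : beta < beta1.
  rewrite ltNge; apply/negP => /(cgf_term_nondecreasing P bg b10 b0).
  apply/negP; rewrite -ltNge -(ltrD2r (- cgf_term P g gamma)).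
  by rewrite (le_lt_trans _ Dk)// lerDl.
rewrite (le_trans hD)// [in leRHS](splitr e) addrA lerD//.
  by rewrite ltW// Hr// gb (lt_trans bb1).
by rewrite ltW// (le_lt_trans _ De)// lerDr subr_ge0.
Qed.

(** The substitution of [- beta] for [beta] matches the two index sets; the orders then add up to 1
    with [P] and [Q] exchanged, so [renyi_sym] identifies the divergences. *)
Lemma Xi_minusE g gamma : gamma != 0 ->
  Xi_minus nu Q P q p g gamma =
  (- Xi_plus nu Q P q p (fun x => - g x)%R (- gamma)%R)%E.
Proof.
move=> g0; rewrite /Xi_minus /Xi_plus -ereal_supN; congr ereal_sup.
have renyiE beta : beta != 0 -> beta != gamma ->
    renyi nu P Q p q (gamma / (gamma - beta)) =
    renyi nu Q P q p (- beta / (- beta - - gamma)).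
  move=> b0 bg; have gb : gamma - beta != 0 by rewrite subr_eq0 eq_sym.
  rewrite opprK [- beta + gamma]addrC.
  have -> : gamma / (gamma - beta) = 1 - - beta / (gamma - beta) by field.
  rewrite (renyi_sym dP dQ)//; first by rewrite mulf_neq0 ?oppr_eq0 ?invr_eq0.
  apply: contra_neq g0 => /(congr1 (fun x => x * (gamma - beta))).
  by rewrite mulfVK// mul1r; lra.
pose minus_term beta := ((cgf_term P g beta - cgf_term P g gamma)%:E -
  ((gamma - beta)^-1)%:E * renyi nu P Q p q (gamma / (gamma - beta)))%E.
pose plus_term beta := ((cgf_term P (fun x => - g x)%R beta -
    cgf_term P (fun x => - g x)%R (- gamma)%R)%:E +
  ((beta - - gamma)^-1)%:E * renyi nu Q P q p (beta / (beta - - gamma)))%E.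
have termE beta : beta != 0 -> beta != gamma ->
    minus_term beta = (- plus_term (- beta)%R)%E.
  move=> b0 bg; rewrite /minus_term /plus_term renyiE// !cgf_termN oppeD// -EFinN.
  by congr (_%:E + - (_^-1%:E * _))%E; [rewrite opprB opprK addrC|rewrite opprK addrC].
apply/seteqP; split => [_ [beta [bg b0 ->]]|_ [_ [beta [bg b0 ->] <-]]].
- exists (plus_term (- beta)).
    by exists (- beta); split; [rewrite ltrN2|rewrite oppr_eq0|].
  by rewrite -termE// lt_eqF.
- have bg' : - beta < gamma by rewrite ltrNl.
  exists (- beta); split; [exact: bg'|by rewrite oppr_eq0|].
  have Nb0 : - beta != 0 by rewrite oppr_eq0.
  have := esym (termE _ Nb0 (negbT (lt_eqF bg'))).
  by rewrite [X in plus_term X]opprK.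
Qed.

End Xi_theory.

Theorem mainTheorem12 (d : measure_display) (T : measurableType d) (R : realType)
  (P Q : probability T R) (nu : {measure set T -> \bar R})
  (p q : T -> R) (g : T -> R) (gamma : R) :
  sigma_finite setT nu ->
  measurable_fun setT p -> measurable_fun setT q ->
  (forall x, 0 <= p x) -> (forall x, 0 <= q x) ->
  (forall A, measurable A -> P A = (\int[nu]_(x in A) (p x)%:E)%E) ->
  (forall A, measurable A -> Q A = (\int[nu]_(x in A) (q x)%:E)%E) ->
  measurable_fun setT g -> (exists M : R, forall x, `|g x| <= M) ->
  gamma != 0 ->
  [/\ (Xi_minus nu Q P q p g gamma <=
        (cgf_term Q g gamma - cgf_term P g gamma)%:E)%E,
      ((cgf_term Q g gamma - cgf_term P g gamma)%:E <=
        Xi_plus nu Q P q p g gamma)%E,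
      Xi_minus nu Q P q p g gamma = (- Xi_plus nu Q P q p (fun x => (- g x)%R) (- gamma)%R)%E,
      (0 <= Xi_plus nu Q P q p g gamma)%E /\ (0 <= - Xi_minus nu Q P q p g gamma)%E
    & ~ (exists c : R, {ae P, forall x, g x = c}) ->
      (Xi_plus nu Q P q p g gamma = 0%E <->
         (forall A, measurable A -> Q A = P A)) /\
      (Xi_minus nu Q P q p g gamma = 0%E <->
         (forall A, measurable A -> Q A = P A))].
Proof.
move=> sf mp mq p0 q0 Pp Qq mg gM g0.
have dP : has_density nu P p by [].
have dQ : has_density nu Q q by [].
have bg : bounded_mfun g by [].
have bNg := bounded_mfunN bg.
have Ng0 : - gamma != 0 by rewrite oppr_eq0.
rewrite (Xi_minusE dP dQ)//; split => //.
(* The upper bound at [(- g, - gamma)] is the negated lower bound at [(g, gamma)]. *)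
- rewrite leeNl; apply: le_trans (cgf_term_le_Xi_plus sf dP dQ bNg Ng0).
  by rewrite !cgf_termN -EFinN lee_fin; lra.
- exact: cgf_term_le_Xi_plus.
- by rewrite oppeK; split; exact: Xi_plus_ge0.
move=> gN; split.
  by split; [exact: Xi_plus_eq0_same|exact: Xi_plus_eq0].
split; last by move=> QP; rewrite (Xi_plus_eq0 sf dP dQ)// oppe0.
move/eqP; rewrite oppe_eq0 => /eqP; apply: (Xi_plus_eq0_same sf dP dQ bNg Ng0).
move=> [c gc]; apply: gN; exists (- c).
by apply: filterS gc => x <-; rewrite opprK.
Qed.
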